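(* Let $E$ and $F$ be Banach lattices with $F$ Dedekind complete, and let ${\mathcal P}$ be a linear subspace of $\mathrm{L}(E,F)$ that is closed in the operator norm and satisfies the domination property. Then $\mathrm{r}\text{-}{\mathcal P}(E,F)$ is a Dedekind complete Banach lattice under the enveloping norm $\|\cdot\|_{\mathrm{r}\text{-}{\mathcal P}}$.
   Context: All vector spaces are real and all operators are linear. $\mathrm{L}(E,F)$ is the space of all continuous linear operators from $E$ to $F$, with operator norm $\|\cdot\|$. It is ordered by $S\le T$ iff $Sx\le Tx$ for all $x\in E_+$, where $E_+$ is the positive cone of $E$; $\mathrm{L}_+(E,F)$ denotes the set of positive operators in $\mathrm{L}(E,F)$, i.e. those $T$ with $0\le T$. ${\mathcal P}\subseteq \mathrm{L}(E,F)$ satisfies the domination property if, for all $S,T\in\mathrm{L}(E,F)$, $0\le S\le T$ and $T\in{\mathcal P}$ imply $S\in{\mathcal P}$. For ${\mathcal P}\subseteq \mathrm{L}(E,F)$, an operator $T:E\to F$ is a regularly ${\mathcal P}$-operator if $T=T_1-T_2$ for some $T_1,T_2\in{\mathcal P}\cap \mathrm{L}_+(E,F)$; the set of all such operators is denoted $\mathrm{r}\text{-}{\mathcal P}(E,F)$ and carries the order inherited from $\mathrm{L}(E,F)$. For a linear subspace ${\mathcal P}$ of $\mathrm{L}(E,F)$, the enveloping norm on $\mathrm{r}\text{-}{\mathcal P}(E,F)$ is $\|T\|_{\mathrm{r}\text{-}{\mathcal P}}:=\inf\{\|S\| : S\in{\mathcal P},\ T\le S \text{ and } -T\le S\}$.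 *)

(* Defs.v *)
From HB Require Import structures.
From mathcomp Require Import all_boot all_order all_algebra.
From mathcomp Require Import all_classical all_reals all_analysis.

Set Implicit Arguments.
Unset Strict Implicit.
Unset Printing Implicit Defensive.

Import Order.TTheory GRing.Theory Num.Theory.
Import numFieldNormedType.Exports.

Local Open Scope classical_set_scope.
Local Open Scope ring_scope.

Reserved Notation "x <=v y" (at level 70, y at next level).

(* The library's [Order.POrder] cannot be joined with [NormedModule] (the join
   is missing below [Num.NumDomain]), so the order is a new operation vle.
   Binary suprema suffice: x /\ y = - ((- x) \/ (- y)). *)
HB.mixin Record Lmodule_isVectorLattice (R : realType) V & GRing.Lmodule R V := {
  vle : V -> V -> Prop ;
  vjoin : V -> V -> V ;
  vle_refl : forall x, vle x x ;
  vle_anti : forall x y, vle x y -> vle y x -> x = y ;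
  vle_trans : forall y x z, vle x y -> vle y z -> vle x z ;
  vle_add2r : forall z x y, vle x y -> vle (x + z) (y + z) ;
  vle_scale_ge0 : forall (a : R) x, 0 <= a -> vle 0 x -> vle 0 (a *: x) ;
  vle_joinl : forall x y, vle x (vjoin x y) ;
  vle_joinr : forall x y, vle y (vjoin x y) ;
  vjoin_le : forall x y z, vle x z -> vle y z -> vle (vjoin x y) z
}.

#[short(type="vectorLatticeType")]
HB.structure Definition VectorLattice (R : realType) :=
  {V of GRing.Lmodule R V & Lmodule_isVectorLattice R V}.

Notation "x <=v y" := (vle x y) : ring_scope.

(* The modulus is an element of V; the notation `|x| is reserved for the norm,
   an element of R. *)
Definition modulus (R : realType) (V : vectorLatticeType R) (x : V) : V :=
  vjoin x (- x).

HB.mixin Record VectorLattice_isBanachLattice (R : realType) V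
    & CompleteNormedModule R V & VectorLattice R V := {
  blat_norm_le : forall x y : V, modulus x <=v modulus y -> `|x| <= `|y|
}.

#[short(type="banachLatticeType")]
HB.structure Definition BanachLattice (R : realType) :=
  {V of CompleteNormedModule R V & VectorLattice R V
      & VectorLattice_isBanachLattice R V}.

Definition dedekind_complete (R : realType) (V : vectorLatticeType R) : Prop :=
  forall A : set V, A !=set0 ->
    (exists u, forall x, A x -> x <=v u) ->
    exists s, (forall x, A x -> x <=v s) /\
              (forall u, (forall x, A x -> x <=v u) -> s <=v u).

(* The subset D of V, with the linear structure of V, the order le and the norm
   nrm, is a Dedekind complete Banach lattice.  X is D equipped with its
   structure and i is the inclusion of D into V.  Only the values of le and nrm
   on D matter. *)
Definition dedekind_complete_banach_lattice_on (R : realType) (V : lmodType R)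
    (D : set V) (le : V -> V -> Prop) (nrm : V -> R) : Prop :=
  exists (X : banachLatticeType R) (i : {linear X -> V}),
    [/\ injective i,
        range i = D,
        (forall x y : X, x <=v y <-> le (i x) (i y)),
        (forall x : X, `|x| = nrm (i x)) &
        dedekind_complete X].

Section Operators.
Variables (R : realType) (E F : banachLatticeType R).

(* Operators are elements of the space E -> F of all functions, with its
   pointwise linear structure. *)
Definition bounded_operators : set (E -> F) :=
  [set T | linear T /\ continuous T].

Definition opnorm (T : E -> F) : R :=
  sup [set `|T x| | x in [set x | `|x| <= 1]].

Definition op_le (S T : E -> F) : Prop := forall x : E, 0 <=v x -> S x <=v T x.

Definition operator_subspace (P : set (E -> F)) : Prop :=
  [/\ P `<=` bounded_operators,
      P 0 &
      forall (a : R) (S T : E -> F), P S -> P T -> P (a *: S + T)].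

Definition opnorm_closed (P : set (E -> F)) : Prop :=
  forall T, bounded_operators T ->
    (forall e : R, 0 < e -> exists2 S, P S & opnorm (T - S) < e) -> P T.

Definition domination_property (P : set (E -> F)) : Prop :=
  forall S T, bounded_operators S -> bounded_operators T ->
    op_le 0 S -> op_le S T -> P T -> P S.

Definition regularly (P : set (E -> F)) : set (E -> F) :=
  [set T | exists T1 T2 : E -> F,
    [/\ P T1, op_le 0 T1, P T2, op_le 0 T2 & T = T1 - T2]].

Definition enveloping_norm (P : set (E -> F)) (T : E -> F) : R :=
  inf [set opnorm S | S in [set S | [/\ P S, op_le T S & op_le (- T) S]]].

End Operators.

(* Main.v *)
Require Import Defs.
From HB Require Import structures.
From mathcomp Require Import all_boot all_order all_algebra.
From mathcomp Require Import all_classical all_reals all_analysis.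
From mathcomp Require Import lra.

Set Implicit Arguments.
Unset Strict Implicit.
Unset Printing Implicit Defensive.

Import Order.TTheory GRing.Theory Num.Theory.
Import numFieldNormedType.Exports.

Local Open Scope classical_set_scope.
Local Open Scope ring_scope.

(** Write D for the regularly P-operators.  Everything rests on one
    description of D ([regularlyP]): a linear T belongs to D exactly when some M
    in P satisfies T <= M and - T <= M.  For such M, T = M - (M - T), and M - T is in
    P because 0 <= M - T <= M + M.  Here the domination property applies because
    a linear map majorized by a continuous M satisfies |Tx| <= M|x|, hence is
    itself continuous, with norm at most that of M ([majorizes_norm]).

    Order.  If a nonempty set A of linear maps is bounded above by a linear U,
    its supremum at x >= 0 is the supremum in F of the sums T1 x1 + ... + Tn xn
    with Ti in A, xi >= 0 and x1 + ... + xn = x.  The Riesz decomposition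
    property of E makes this expression additive in x, so that it extends to a
    linear map on E ([operator_supremum]).  For A inside D and U in D, the
    supremum lies between an element of D and U, hence is in D
    ([regularly_between]).  Taking for A a pair gives the lattice operations.
    Every P-majorant of T belongs to D and therefore lies above the modulus of T
    computed in D, which yields the lattice norm property
    ([enveloping_norm_mono]).

    Completeness.  Let (T n) be a sequence in D whose consecutive differences
    have enveloping norm at most 2^-n.  Choose M n in P majorizing
    T (n+1) - T n, of operator norm at most 2 * 2^-n.  The partial sums U n of
    the M n converge in operator norm to some W, which is in P since P is
    closed, and T n converges pointwise to a linear L.  As U m - U n majorizes
    T m - T n for n <= m, and the positive cone of F is closed, W - U n
    majorizes L - T n.  Hence L is in D and T n tends to L in the enveloping
    norm ([enveloping_norm_complete]).

    Finally [dedekind_banach_subspace] turns these facts about D into a Banach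
    lattice whose carrier is D. *)

(** * Completeness tested on geometric Cauchy sequences *)

Lemma half_pow_small (R : realType) (c e : R) :
  0 < e -> exists n, c * 2^-1 ^+ n < e.
Proof.
move=> e0; exists (Num.bound `|c / e|).
rewrite exprVn ltr_pdivrMr ?exprn_gt0// mulrC -ltr_pdivrMr//.
apply: (le_lt_trans (ler_norm _)); apply: lt_trans (archi_boundP (normr_ge0 _)) _.
by rewrite -natrX ltr_nat ltn_expl.
Qed.

Section GeometricCauchy.
Variables (R : realType) (V : normedModType R).

(** A Cauchy filter has, for each n, a ball of radius 2^-n / 2 among its members.
    Two balls of the filter meet, so the centres form a sequence with geometric
    increments, and its limit is the limit of the filter. *)
Lemma cauchy_filter_cvg_of_geometric (F : set_system V) :
  (forall u : nat -> V, (forall n, `|u n.+1 - u n| <= 2^-1 ^+ n) ->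
    exists l, forall n, `|l - u n| <= 4 * 2^-1 ^+ n) ->
  ProperFilter F -> cauchy F -> cvg F.
Proof.
move=> geo PF /cauchyP FC.
have r0 n : 0 < 2^-1 ^+ n / 2 :> R by rewrite divr_gt0 ?exprn_gt0 ?invr_gt0.
have /choice[u Fu] : forall n : nat, exists x, F (ball x (2^-1 ^+ n / 2)).
  by move=> n; exact: FC.
have [n|l ul] := geo u.
  have [z /= [zn zn1]] := filter_ex (filterI (Fu n) (Fu n.+1)).
  move: zn zn1; rewrite -!ball_normE/= => zn zn1.
  apply: le_trans (ler_distD z _ _) _; rewrite (distrC z).
  have : 2^-1 ^+ n.+1 = 2^-1 ^+ n / 2 :> R by rewrite exprS mulrC.
  rewrite /= in zn zn1 *; move=> h; rewrite h in zn1; have := r0 n; lra.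
apply/cvg_ex; exists l; apply/cvg_ballP => e e0.
(* 5 covers the bound 4 on the distance to the limit plus the radius 1/2. *)
have [n ne] := half_pow_small 5 e0.
apply: filterS (Fu n) => z; rewrite -!ball_normE/= => uz.
apply: le_lt_trans (ler_distD (u n) _ _) _.
have := ul n; have := r0 n; lra.
Qed.

End GeometricCauchy.

(** * Dedekind complete Banach lattices on a subset of a vector space *)

(** These are conditions on a subset D of V, its order and its norm that are
    checked without forming the type of elements of D.  Binary joins come out of
    [dba_pair] and [dba_sup].  The lattice norm property [dba_norm_le] compares
    the upper bounds of y and - y with those of x and - x, which avoids moduli;
    completeness is asked of sequences with geometric increments only. *)
Record dedekind_banach_axioms (R : realType) (V : lmodType R) (D : set V)
    (le : V -> V -> Prop) (nrm : V -> R) : Prop := {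
  dba_0 : D 0 ;
  dba_lin : forall a x y, D x -> D y -> D (a *: x + y) ;
  dba_refl : forall x, D x -> le x x ;
  dba_anti : forall x y, D x -> D y -> le x y -> le y x -> x = y ;
  dba_trans : forall y x z, D x -> D y -> D z -> le x y -> le y z -> le x z ;
  dba_add2r : forall z x y, D x -> D y -> D z -> le x y -> le (x + z) (y + z) ;
  dba_scale_ge0 : forall a x, D x -> 0 <= a -> le 0 x -> le 0 (a *: x) ;
  dba_pair : forall x y, D x -> D y -> exists z, [/\ D z, le x z & le y z] ;
  dba_sup : forall A : set V, A `<=` D -> A !=set0 ->
    (exists2 u, D u & forall x, A x -> le x u) ->
    exists s, [/\ D s, forall x, A x -> le x s &
      forall u, D u -> (forall x, A x -> le x u) -> le s u] ;
  dba_normD : forall x y, D x -> D y -> nrm (x + y) <= nrm x + nrm y ;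
  dba_normZ : forall a x, D x -> nrm (a *: x) = `|a| * nrm x ;
  dba_norm0 : forall x, D x -> nrm x = 0 -> x = 0 ;
  dba_norm_le : forall x y, D x -> D y ->
    (forall z, D z -> le y z -> le (- y) z -> le x z /\ le (- x) z) ->
    nrm x <= nrm y ;
  dba_complete : forall u : nat -> V, (forall n, D (u n)) ->
    (forall n, nrm (u n.+1 - u n) <= 2^-1 ^+ n) ->
    exists2 l, D l & forall n, nrm (l - u n) <= 4 * 2^-1 ^+ n
}.

(** The proof of the axioms is a parameter of the carrier so that the canonical
    structures below, which depend on it, can be inferred from the type. *)
Definition dba_sort (R : realType) (V : lmodType R) (D : set V)
    (le : V -> V -> Prop) (nrm : V -> R)
    & dedekind_banach_axioms D le nrm : Type := {x : V | x \in D}.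

Section DedekindBanachSubspace.
Variables (R : realType) (V : lmodType R) (D : set V).
Variables (le : V -> V -> Prop) (nrm : V -> R).
Variable ax : dedekind_banach_axioms D le nrm.
Local Notation X := (dba_sort ax).

HB.instance Definition _ := [isSub of X for @sval V (fun x => x \in D)].
HB.instance Definition _ := [Choice of X by <:].

Fact dba_submod : submod_closed [in D].
Proof.
split; first by rewrite inE; exact: dba_0 ax.
by move=> a x y; rewrite !inE => Dx Dy; exact: (dba_lin ax).
Qed.

HB.instance Definition _ :=
  GRing.SubChoice_isSubLmodule.Build R V [in D] X dba_submod.

Let DX (x : X) : D (val x). Proof. by have := valP x; rewrite inE. Qed.

#[local] Hint Extern 0 (D _) => exact: DX : core.

Let mkX (x : V) (Dx : D x) : X := Sub x (mem_set Dx).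

Fact dba_normD_sub (x y : X) :
  nrm (val (x + y)) <= nrm (val x) + nrm (val y).
Proof. by rewrite raddfD; exact: (dba_normD ax). Qed.

Fact dba_normZ_sub a (x : X) : nrm (val (a *: x)) = `|a| * nrm (val x).
Proof. by rewrite linearZ; exact: (dba_normZ ax). Qed.

Fact dba_norm0_sub (x : X) : nrm (val x) = 0 -> x = 0.
Proof. by move/(dba_norm0 ax (DX x)) => x0; apply: val_inj; rewrite raddf0. Qed.

HB.instance Definition _ := @Lmodule_isNormed.Build R X
  (fun x : X => nrm (val x)) dba_normD_sub dba_normZ_sub dba_norm0_sub.

Fact dba_cauchy_cvg (F : set_system X) : ProperFilter F -> cauchy F -> cvg F.
Proof.
apply: cauchy_filter_cvg_of_geometric => u uC.
have [n|n|l Dl lu] := dba_complete ax (u := fun n => val (u n)).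
- exact: DX.
- by have := uC n; rewrite -raddfB.
- by exists (mkX Dl) => n; have := lu n; rewrite -{1}[l]/(val (mkX Dl)) -raddfB.
Qed.

HB.instance Definition _ := Uniform_isComplete.Build X dba_cauchy_cvg.

Fact dba_join_exists (x y : X) : exists s : X,
  [/\ le (val x) (val s), le (val y) (val s) &
   forall z : X, le (val x) (val z) -> le (val y) (val z) -> le (val s) (val z)].
Proof.
have [z [Dz xz yz]] := dba_pair ax (DX x) (DX y).
have [|||s [Ds sub sle]] := dba_sup ax (A := [set val x; val y]).
- by move=> _ [->|->]; exact: DX.
- by exists (val x); left.
- by exists z => // _ [->|->].
exists (mkX Ds); split => [||t xt yt].
- by apply: sub; left.
- by apply: sub; right.
- by apply: sle => // _ [->|->].
Qed.

Let join (x y : X) : X := sval (cid (dba_join_exists x y)).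

Let le_sub (x y : X) : Prop := le (val x) (val y).

Fact dba_vle_refl x : le_sub x x.
Proof. exact: (dba_refl ax). Qed.

Fact dba_vle_anti x y : le_sub x y -> le_sub y x -> x = y.
Proof. by move=> xy yx; apply: val_inj; exact: (dba_anti ax). Qed.

Fact dba_vle_trans y x z : le_sub x y -> le_sub y z -> le_sub x z.
Proof. exact: (dba_trans ax). Qed.

Fact dba_vle_add2r z x y : le_sub x y -> le_sub (x + z) (y + z).
Proof. by move=> xy; rewrite /le_sub !raddfD; exact: (dba_add2r ax). Qed.

Fact dba_vle_scale_ge0 (a : R) x : 0 <= a -> le_sub 0 x -> le_sub 0 (a *: x).
Proof.
rewrite /le_sub raddf0 => a0 x0; rewrite linearZ.
exact: (dba_scale_ge0 ax).
Qed.

Fact dba_joinl x y : le_sub x (join x y).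
Proof. by rewrite /join; case: cid => s /= []. Qed.

Fact dba_joinr x y : le_sub y (join x y).
Proof. by rewrite /join; case: cid => s /= []. Qed.

Fact dba_join_le x y z : le_sub x z -> le_sub y z -> le_sub (join x y) z.
Proof. by rewrite /join; case: cid => s /= [_ _]; exact. Qed.

HB.instance Definition _ := Lmodule_isVectorLattice.Build R X
  dba_vle_refl dba_vle_anti dba_vle_trans dba_vle_add2r dba_vle_scale_ge0
  dba_joinl dba_joinr dba_join_le.

Fact dba_blat_norm_le (x y : X) :
  modulus x <=v modulus y -> `|x| <= `|y|.
Proof.
move=> xy; apply: (dba_norm_le ax) => // z Dz yz Nyz.
have yz' : modulus y <=v (mkX Dz) by apply: vjoin_le => //; rewrite /vle/= raddfN.
have xz : modulus x <=v (mkX Dz) by exact: vle_trans xy yz'.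
have xz1 : x <=v mkX Dz by apply: vle_trans xz; exact: vle_joinl.
have xz2 : (- x) <=v mkX Dz by apply: vle_trans xz; exact: vle_joinr.
by split=> //; move: xz2; rewrite /vle/= /le_sub raddfN.
Qed.

HB.instance Definition _ :=
  VectorLattice_isBanachLattice.Build R X dba_blat_norm_le.

Fact dba_dedekind_complete : dedekind_complete X.
Proof.
move=> A [a Aa] [u ub].
have [|||s [Ds sub sle]] := dba_sup ax (A := val @` A).
- by move=> _ [x _ <-].
- by exists (val a), a.
- by exists (val u) => // _ [x Ax <-]; exact: ub.
exists (mkX Ds); split => [x Ax|v vub]; first by apply: sub; exists x.
by apply: sle => // _ [x Ax <-]; exact: vub.
Qed.

Lemma dedekind_banach_subspace :
  dedekind_complete_banach_lattice_on D le nrm.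
Proof.
exists X, (\val : {linear X -> V}); split=> //.
- apply/seteqP; split => [_ [x _ <-]//|x Dx].
  by exists (mkX Dx).
- exact: dba_dedekind_complete.
Qed.

End DedekindBanachSubspace.

(** * Vector lattices and the Riesz decomposition *)

Section VectorLatticeTheory.
Variables (R : realType) (V : vectorLatticeType R).
Implicit Types x y z : V.

Lemma vle_add2l z x y : x <=v y -> z + x <=v z + y.
Proof. by rewrite ![z + _]addrC; exact: vle_add2r. Qed.

Lemma vle_add x1 y1 x2 y2 : x1 <=v y1 -> x2 <=v y2 -> x1 + x2 <=v y1 + y2.
Proof.
move=> h1 h2; apply: (@vle_trans _ _ (y1 + x2)); first exact: vle_add2r.
exact: vle_add2l.
Qed.

Lemma vsub_ge0 x y : 0 <=v y - x <-> x <=v y.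
Proof.
split=> [/(vle_add2r x)|/(vle_add2r (- x))]; first by rewrite add0r subrK.
by rewrite subrr.
Qed.

Lemma vle_opp x y : x <=v y -> - y <=v - x.
Proof. by move=> /vsub_ge0 xy; apply/vsub_ge0; rewrite opprK addrC. Qed.

Lemma vle_scale (a : R) x y : 0 <= a -> x <=v y -> a *: x <=v a *: y.
Proof.
by move=> a0 /vsub_ge0 xy; apply/vsub_ge0; rewrite -scalerBr; exact: vle_scale_ge0.
Qed.

Lemma vle_sym_ge0 x y : x <=v y -> - x <=v y -> 0 <=v y.
Proof.
move=> xy Nxy; have := vle_add xy Nxy; rewrite subrr => yy.
have -> : y = 2^-1 *: (y + y).
  by rewrite scalerDr -scalerDl -{1}[y]scale1r; congr (_ *: _); lra.
by apply: vle_scale_ge0.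
Qed.

Lemma addv_ge0 x y : 0 <=v x -> 0 <=v y -> 0 <=v x + y.
Proof. by move=> x0 y0; rewrite -[0]addr0; exact: vle_add. Qed.

Lemma vopp_le_self x : 0 <=v x -> - x <=v x.
Proof.
move=> x0; apply: (@vle_trans _ _ 0) => //.
by rewrite -[X in _ <=v X]oppr0; exact: vle_opp.
Qed.

Lemma modulus_ge0 x : 0 <=v modulus x.
Proof. by apply: (@vle_sym_ge0 x); [exact: vle_joinl|exact: vle_joinr]. Qed.

(** The positive and negative parts of x, obtained as the halves of |x| + x and
    |x| - x. *)
Lemma modulus_decomp x : exists p q,
  [/\ 0 <=v p, 0 <=v q, x = p - q & modulus x = p + q].
Proof.
have half y : 2^-1 *: y + 2^-1 *: y = y.
  by rewrite -scalerDl -[RHS]scale1r; congr (_ *: _); lra.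
have h0 : (0 : R) <= 2^-1 by lra.
exists (2^-1 *: (modulus x + x)), (2^-1 *: (modulus x - x)); split.
- apply: vle_scale_ge0 => //; rewrite -[x in _ + x]opprK.
  by apply/vsub_ge0; exact: vle_joinr.
- by apply: vle_scale_ge0 => //; apply/vsub_ge0; exact: vle_joinl.
- by rewrite !scalerDr scalerN opprB [X in X + _]addrC addrACA subrr addr0 half.
- by rewrite !scalerDr scalerN addrACA subrr addr0 half.
Qed.

(** Two decompositions of the same positive element have a common refinement.  The
    part of c taken from b is the least one possible, (c - a) \/ 0; the other
    three parts are then forced, and their positivity is the minimality of the
    join. *)
Lemma riesz_refinement (a b c d : V) :
  0 <=v a -> 0 <=v b -> 0 <=v c -> 0 <=v d -> a + b = c + d ->
  exists ca cb da db, [/\ [/\ 0 <=v ca, 0 <=v cb, 0 <=v da & 0 <=v db],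
    c = ca + cb, d = da + db, a = ca + da & b = cb + db].
Proof.
move=> a0 b0 c0 d0 abcd.
have dE : d = a + b - c by rewrite abcd addrC addKr.
pose cb := vjoin (c - a) 0.
have cb_b : cb <=v b.
  apply: vjoin_le => //; apply/vsub_ge0.
  by rewrite opprB addrCA addrA -dE.
exists (c - cb), cb, (a - c + cb), (b - cb); split.
- split; last 1 first.
  + exact/vsub_ge0.
  + apply/vsub_ge0; apply: vjoin_le => //.
    by apply/vsub_ge0; rewrite opprB addrC subrK.
  + exact: vle_joinr.
  + by rewrite -(opprB c a) addrC; apply/vsub_ge0; exact: vle_joinl.
- by rewrite subrK.
- by rewrite dE [b - cb]addrC addrA addrK addrAC.
- by rewrite addrACA addNr addr0 addrC subrK.
- by rewrite addrC subrK.
Qed.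

End VectorLatticeTheory.

(** * Linear maps given as functions *)

Section LinearFunctions.
Variables (R : realType) (E F : lmodType R) (T : E -> F).
Hypothesis linT : linear T.

Definition bundle_linear : {linear E -> F} :=
  HB.pack T (GRing.isLinear.Build R E F *:%R T linT).

Lemma linfun0 : T 0 = 0. Proof. exact: (linear0 bundle_linear). Qed.

Lemma linfunD x y : T (x + y) = T x + T y.
Proof. exact: (linearD bundle_linear). Qed.

Lemma linfunB x y : T (x - y) = T x - T y.
Proof. exact: (linearB bundle_linear). Qed.

Lemma linfunZ a x : T (a *: x) = a *: T x.
Proof. exact: (linearZ_LR bundle_linear). Qed.

End LinearFunctions.

Lemma linear_axpy (R : realType) (E F : lmodType R) (a : R) (S T : E -> F) :
  linear S -> linear T -> linear (a *: S + T).
Proof.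
move=> lS lT b x y; rewrite -[LHS]/(a *: S _ + T _) lS lT.
rewrite -[in RHS]/(a *: S _ + T _) !scalerDr !scalerA [b * a]mulrC.
by rewrite addrACA.
Qed.

Lemma linearB_fun (R : realType) (E F : lmodType R) (S T : E -> F) :
  linear S -> linear T -> linear (S - T).
Proof.
move=> lS lT; have := linear_axpy (-1) lT lS.
by rewrite scaleN1r addrC.
Qed.

(** * Suprema of sets of operators *)

Section PositiveExtension.
Variables (R : realType) (E : vectorLatticeType R) (F : lmodType R).

(** The value f p - f q depends on p - q only, because p - q = p' - q' means
    p + q' = p' + q.  This defines the extension, and its linearity is read off
    from decompositions into positive elements. *)
Lemma cone_additive_extension (f : E -> F) :
  (forall x y, 0 <=v x -> 0 <=v y -> f (x + y) = f x + f y) ->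
  (forall (a : R) x, 0 < a -> 0 <=v x -> f (a *: x) = a *: f x) ->
  exists2 T : E -> F, linear T & forall x, 0 <=v x -> T x = f x.
Proof.
move=> fD fZ.
have f0 : f 0 = 0.
  by apply: (addrI (f 0)); rewrite -fD ?addr0//; exact: vle_refl.
have /choice[T TE] : forall x, exists t : F, forall p q,
    0 <=v p -> 0 <=v q -> x = p - q -> t = f p - f q.
  move=> x; have [p [q [p0 q0 -> _]]] := modulus_decomp x.
  exists (f p - f q) => p' q' p'0 q'0 pq.
  have : p + q' = p' + q by apply/eqP; rewrite -subr_eq addrAC pq subrK.
  by move/(congr1 f); rewrite !fD// => /eqP; rewrite -subr_eq addrAC => /eqP <-;
    rewrite addrK.
have TD x y : T (x + y) = T x + T y.
  have [p [q [p0 q0 xE _]]] := modulus_decomp x.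
  have [r [s [r0 s0 yE _]]] := modulus_decomp y.
  have pr0 : 0 <=v p + r by exact: addv_ge0.
  have qs0 : 0 <=v q + s by exact: addv_ge0.
  have xyE : x + y = p + r - (q + s) by rewrite xE yE opprD addrACA.
  rewrite (TE _ _ _ p0 q0 xE) (TE _ _ _ r0 s0 yE) (TE _ _ _ pr0 qs0 xyE).
  by rewrite !fD// opprD addrACA.
have TN x : T (- x) = - T x.
  have [p [q [p0 q0 xE _]]] := modulus_decomp x.
  have NxE : - x = q - p by rewrite xE opprB.
  by rewrite (TE _ _ _ p0 q0 xE) (TE _ _ _ q0 p0 NxE) opprB.
have TZpos a x : 0 < a -> T (a *: x) = a *: T x.
  move=> a0; have [p [q [p0 q0 xE _]]] := modulus_decomp x.
  have axE : a *: x = a *: p - a *: q by rewrite xE scalerBr.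
  rewrite (TE _ _ _ p0 q0 xE) scalerBr -!fZ//.
  apply: TE axE; exact: vle_scale_ge0 (ltW a0) _.
have Tf x : 0 <=v x -> T x = f x.
  by move=> x0; rewrite (TE _ _ _ x0 (vle_refl 0) (esym (subr0 x))) f0 subr0.
exists T => // a x y; rewrite TD; congr (_ + _).
have [a0|a0|->] := ltgtP a 0; last 1 first.
- by rewrite !scale0r Tf ?f0//; exact: vle_refl.
- by rewrite -[a in LHS]opprK scaleNr TN TZpos ?oppr_gt0// scaleNr opprK.
- exact: TZpos.
Qed.

End PositiveExtension.

Section OperatorSupremum.
Variables (R : realType) (E F : banachLatticeType R).

(** [splitting_sum A x v] says that v = T1 x1 + ... + Tn xn for some Ti in A and
    xi >= 0 with sum x.  As an inductive predicate it is stable under sums by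
    concatenation and can be split along x = y + z one term at a time. *)
Inductive splitting_sum (A : set (E -> F)) : E -> F -> Prop :=
| splitting_sum_nil : splitting_sum A 0 0
| splitting_sum_cons T y x v : A T -> 0 <=v y -> splitting_sum A x v ->
    splitting_sum A (y + x) (T y + v).

Variable A : set (E -> F).
Hypothesis linA : forall T, A T -> linear T.

Lemma splitting_sum_ge0 x v : splitting_sum A x v -> 0 <=v x.
Proof.
elim=> [|T y z w _ y0 _ z0]; first exact: vle_refl.
by exact: addv_ge0.
Qed.

Lemma splitting_sumD x y v w : splitting_sum A x v -> splitting_sum A y w ->
  splitting_sum A (x + y) (v + w).
Proof.
move=> + sy; elim=> [|T z x' v' AT z0 _ IH]; first by rewrite !add0r.
by rewrite -!addrA; exact: splitting_sum_cons.
Qed.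

Lemma splitting_sumZ a x v : 0 <= a -> splitting_sum A x v ->
  splitting_sum A (a *: x) (a *: v).
Proof.
move=> a0; elim=> [|T z x' v' AT z0 _ IH].
  by rewrite !scaler0; exact: splitting_sum_nil.
rewrite !scalerDr -(linfunZ (linA AT)); apply: splitting_sum_cons => //.
exact: vle_scale_ge0.
Qed.

(** Each xi is cut into a part for x and a part for y by the Riesz refinement; the
    corresponding value is cut by additivity of Ti. *)
Lemma splitting_sum_split x y w : 0 <=v x -> 0 <=v y ->
  splitting_sum A (x + y) w -> exists v1 v2,
    [/\ splitting_sum A x v1, splitting_sum A y v2 & w = v1 + v2].
Proof.
move=> + + s; move: {-2}(x + y) s (erefl (x + y)) => z s.
elim: s x y => {z w} [|T c d v AT c0 sd IH] x y zE x0 y0.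
  have -> : x = 0.
    apply: vle_anti => //; rewrite -[x](addrK y) zE sub0r.
    by rewrite -[0]oppr0; exact: vle_opp.
  have -> : y = 0.
    apply: vle_anti => //; rewrite -[y](addrK x) addrC [y + x]addrC zE addr0.
    by rewrite -[0]oppr0; exact: vle_opp.
  by exists 0, 0; split; rewrite ?addr0//; exact: splitting_sum_nil.
have d0 := splitting_sum_ge0 sd.
have [cx [cy [dx [dy [[cx0 cy0 dx0 dy0] cE dE xE yE]]]]] :=
  riesz_refinement x0 y0 c0 d0 zE.
have [v1 [v2 [s1 s2 vE]]] := IH _ _ (esym dE) dx0 dy0.
exists (T cx + v1), (T cy + v2); split.
- by rewrite xE; exact: splitting_sum_cons.
- by rewrite yE; exact: splitting_sum_cons.
- by rewrite vE cE (linfunD (linA AT)) addrACA.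
Qed.

Lemma splitting_sum_le (U : E -> F) : linear U ->
  (forall T, A T -> op_le T U) ->
  forall x v, splitting_sum A x v -> v <=v U x.
Proof.
move=> lU AU x v; elim=> [|T z x' v' AT z0 _ IH].
  by rewrite linfun0//; exact: vle_refl.
by rewrite (linfunD lU); apply: vle_add => //; exact: AU.
Qed.

(** The map x |-> sup of the splitting sums of x is superadditive on the positive
    cone because splitting sums can be added, and subadditive because they can
    be split; it is then extended to E. *)
Lemma operator_supremum (U : E -> F) : dedekind_complete F ->
  A !=set0 -> linear U -> (forall T, A T -> op_le T U) ->
  exists S : E -> F, [/\ linear S, forall T, A T -> op_le T S &
    forall W, linear W -> (forall T, A T -> op_le T W) -> op_le S W].
Proof.
move=> dcF [T0 AT0] lU AU.
have one T x : A T -> 0 <=v x -> splitting_sum A x (T x).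
  move=> AT x0; rewrite -[x in splitting_sum _ x _]addr0 -[T x]addr0.
  exact: splitting_sum_cons AT x0 (splitting_sum_nil _).
(* Outside the positive cone the value of f is arbitrary. *)
have /choice[f fP] : forall x, exists s : F, 0 <=v x ->
    (forall v, splitting_sum A x v -> v <=v s) /\
    (forall u, (forall v, splitting_sum A x v -> v <=v u) -> s <=v u).
  move=> x; have [x0|nx0] := pselect (0 <=v x); last by exists 0.
  have [||s sP] := dcF (splitting_sum A x).
  - by exists (T0 x); exact: one.
  - by exists (U x) => v; exact: splitting_sum_le.
  - by exists s.
have [||S linS SE] := @cone_additive_extension _ _ _ f.
- move=> x y x0 y0.
  have xy0 : 0 <=v x + y by exact: addv_ge0.
  have [fub flub] := fP _ xy0.
  have [fxub fxlub] := fP _ x0; have [fyub fylub] := fP _ y0.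
  apply: vle_anti.
    apply: flub => v /(splitting_sum_split x0 y0)[v1 [v2 [s1 s2 ->]]].
    by apply: vle_add; [exact: fxub|exact: fyub].
  rewrite -[f (x + y)](subrK (f y)); apply: vle_add2r; apply: fxlub => v sv.
  apply/vsub_ge0; rewrite addrAC; apply/vsub_ge0; apply: fylub => w sw.
  apply/vsub_ge0; rewrite addrAC -addrA -opprD; apply/vsub_ge0.
  by rewrite addrC; apply: fub; exact: splitting_sumD.
- have fZ (a : R) x : 0 < a -> 0 <=v x -> a *: f x <=v f (a *: x).
    move=> a0 x0.
    have [fub _] := fP _ (vle_scale_ge0 _ _ (ltW a0) x0); have [_ flub] := fP _ x0.
    have -> : f (a *: x) = a *: (a^-1 *: f (a *: x)).
      by rewrite scalerA mulfV ?scale1r ?gt_eqF.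
    apply: vle_scale (ltW a0) _; apply: flub => v sv.
    have -> : v = a^-1 *: (a *: v) by rewrite scalerA mulVf ?scale1r ?gt_eqF.
    apply: vle_scale; first by rewrite invr_ge0 ltW.
    by apply: fub; apply: splitting_sumZ sv; exact: ltW.
  move=> a x a0 x0; apply: vle_anti; last exact: fZ.
  have ax0 := vle_scale_ge0 _ _ (ltW a0) x0.
  have ai0 : 0 < a^-1 by rewrite invr_gt0.
  have := vle_scale (ltW a0) (fZ _ _ ai0 ax0).
  by rewrite !scalerA mulfV ?mulVf ?scale1r ?gt_eqF.
exists S; split=> // [T AT x x0|W linW AW x x0]; rewrite SE//.
- by have [fub _] := fP _ x0; apply: fub; exact: one.
- by have [_ flub] := fP _ x0; apply: flub => v; exact: splitting_sum_le.
Qed.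

End OperatorSupremum.

(** * The norm of a Banach lattice *)

Section BanachLatticeTheory.
Variables (R : realType) (F : banachLatticeType R).
Implicit Types x y : F.

Lemma norm_le_of_vle x y : x <=v y -> - x <=v y -> `|x| <= `|y|.
Proof.
move=> xy Nxy; apply: blat_norm_le.
by apply: vle_trans (vle_joinl y (- y)); exact: vjoin_le.
Qed.

Lemma norm_modulus_le x : `|modulus x| <= `|x|.
Proof.
apply: blat_norm_le; apply: vjoin_le; first exact: vle_refl.
by apply: vopp_le_self; exact: modulus_ge0.
Qed.

(** The positive cone is closed: if y >= 0 then the negative part of x is at most
    |y - x|, so its norm is at most the distance from x to the cone. *)
Lemma vle0_closed x :
  (forall e : R, 0 < e -> exists2 y, 0 <=v y & `|x - y| <= e) -> 0 <=v x.
Proof.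
move=> xP; pose z := vjoin (- x) 0.
have z0 : 0 <=v z by exact: vle_joinr.
suff zE : z = 0.
  by rewrite -[x]opprK -[0]oppr0; apply: vle_opp; rewrite -zE; exact: vle_joinl.
apply/eqP; rewrite -normr_le0; apply/ler_addgt0Pr => e e0; rewrite add0r.
have [y y0 xy] := xP e e0.
apply: le_trans xy; rewrite distrC.
apply: le_trans (norm_modulus_le _).
have zy : z <=v modulus (y - x).
  apply: vjoin_le; last exact: modulus_ge0.
  apply: vle_trans (vle_joinl _ _).
  by rewrite -[X in X <=v _]add0r; exact: vle_add2r.
by apply: norm_le_of_vle => //; apply: vle_trans zy; exact: vopp_le_self.
Qed.

End BanachLatticeTheory.

(** * The operator norm and majorized operators *)

Section OperatorNorm.
Variables (R : realType) (E F : banachLatticeType R).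
Implicit Types S T : E -> F.

Lemma bounded_operator_of_le T (c : R) : linear T ->
  (forall x, `|T x| <= c * `|x|) -> bounded_operators T.
Proof.
move=> lT Tc; split=> //.
have : continuous (bundle_linear lT); last by [].
apply: bounded_linear_continuous; apply/linear_boundedP.
exists c; split; first exact: num_real.
move=> r cr x; apply: le_trans (Tc x) _.
by apply: ler_wpM2r => //; exact: ltW.
Qed.

Lemma opnorm_has_sup T : bounded_operators T ->
  has_sup [set `|T x| | x in [set x | `|x| <= 1]].
Proof.
move=> [lT cT]; split; first by exists `|T 0|, 0 => //=; rewrite normr0.
have : bounded_near (bundle_linear lT) (nbhs (0 : E)).
  by apply/linear_bounded_continuous.
move=> /linear_boundedP /pinfty_ex_gt0[r r0 Tr].
exists r => _ [x /= x1 <-]; apply: le_trans (Tr x) _.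
by rewrite -[leRHS]mulr1 ler_pM2l.
Qed.

Lemma opnorm_ge0 T : bounded_operators T -> 0 <= opnorm T.
Proof.
move=> bT; apply: le_trans (normr_ge0 (T 0)) _.
apply: ub_le_sup; first by have [] := opnorm_has_sup bT.
by exists 0 => //=; rewrite normr0.
Qed.

Lemma opnorm_bound T x : bounded_operators T -> `|T x| <= opnorm T * `|x|.
Proof.
move=> bT; have [lT _] := bT.
have [->|x0] := eqVneq x 0; first by rewrite linfun0// !normr0 mulr0.
rewrite -ler_pdivrMr ?normr_gt0//; apply: ub_le_sup.
  by have [] := opnorm_has_sup bT.
exists (`|x|^-1 *: x) => /=; first by rewrite normfZV.
by rewrite linfunZ// normrZ normfV normr_id mulrC.
Qed.

Lemma opnorm_le T (c : R) : 0 <= c -> (forall x, `|T x| <= c * `|x|) ->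
  opnorm T <= c.
Proof.
move=> c0 Tc; apply: ge_sup.
  by exists `|T 0|, 0 => //=; rewrite normr0.
move=> _ [x /= x1 <-]; apply: le_trans (Tc x) _.
by rewrite -[leRHS]mulr1; exact: ler_wpM2l.
Qed.

Lemma opnormD S T : bounded_operators S -> bounded_operators T ->
  opnorm (S + T) <= opnorm S + opnorm T.
Proof.
move=> bS bT; apply: opnorm_le => [|x]; first by rewrite addr_ge0 ?opnorm_ge0.
by rewrite mulrDl (le_trans (ler_normD _ _))// lerD// opnorm_bound.
Qed.

Lemma opnormZ_le (a : R) T : bounded_operators T ->
  opnorm (a *: T) <= `|a| * opnorm T.
Proof.
move=> bT; apply: opnorm_le => [|x]; first by rewrite mulr_ge0 ?opnorm_ge0.
by rewrite normrZ -mulrA ler_wpM2l// opnorm_bound.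
Qed.

Definition majorizes (M T : E -> F) : Prop := op_le T M /\ op_le (- T) M.

Lemma majorizes_ge0 M T : majorizes M T -> op_le 0 M.
Proof.
move=> [TM NTM] x x0.
by apply: (@vle_sym_ge0 _ _ (T x)); [exact: TM|exact: NTM].
Qed.

(** This is the inequality |Tx| <= M|x|, in norm: with x = p - q and
    |x| = p + q one has Tp - Tq <= Mp + Mq, and likewise for - T. *)
Lemma majorizes_modulus M T x : linear T -> linear M -> majorizes M T ->
  `|T x| <= `|M (modulus x)|.
Proof.
move=> lT lM [TM NTM].
have [p [q [p0 q0 -> ->]]] := modulus_decomp x.
apply: norm_le_of_vle; rewrite (linfunB lT) (linfunD lM).
  by apply: vle_add; [exact: TM|exact: NTM].
by rewrite opprB addrC; apply: vle_add; [exact: NTM|exact: TM].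
Qed.

(** Continuity thus passes from a majorant to the majorized linear map, with control
    of the norm. *)
Lemma majorizes_norm M T x : linear T -> bounded_operators M ->
  majorizes M T -> `|T x| <= opnorm M * `|x|.
Proof.
move=> lT bM MT; have [lM _] := bM.
apply: le_trans (majorizes_modulus x lT lM MT) _.
apply: le_trans (opnorm_bound _ bM) _.
by apply: ler_wpM2l; [exact: opnorm_ge0|exact: norm_modulus_le].
Qed.

Lemma op_le_anti S T : linear S -> linear T -> op_le S T -> op_le T S -> S = T.
Proof.
move=> lS lT ST TS; apply/funext => x.
have [p [q [p0 q0 -> _]]] := modulus_decomp x.
have e y : 0 <=v y -> S y = T y.
  by move=> y0; apply: vle_anti; [exact: ST|exact: TS].
by rewrite (linfunB lS) (linfunB lT) !e.
Qed.

Lemma majorizesD M N S T : majorizes M S -> majorizes N T ->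
  majorizes (M + N) (S + T).
Proof.
move=> [SM NSM] [TN NTN]; split=> x x0; first by
  apply: vle_add; [exact: SM|exact: TN].
by rewrite opprD; apply: vle_add; [exact: NSM|exact: NTN].
Qed.

Lemma majorizesZ (a : R) M T : majorizes M T -> majorizes (`|a| *: M) (a *: T).
Proof.
move=> [TM NTM].
have [a0|a0] := leP 0 a.
  rewrite ger0_norm//; split=> x x0; first by apply: vle_scale => //; exact: TM.
  rewrite -[X in X <=v _]/(- (a *: T x)) -scalerN.
  by apply: vle_scale => //; exact: NTM.
have Na0 : 0 <= - a by rewrite oppr_ge0 ltW.
rewrite ltr0_norm//; split=> x x0.
  rewrite -[X in X <=v _]/(a *: T x) -[a in X in X <=v _]opprK scaleNr -scalerN.
  by apply: vle_scale => //; exact: NTM.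
rewrite -[X in X <=v _]/(- (a *: T x)) -scaleNr.
by apply: vle_scale => //; exact: TM.
Qed.

End OperatorNorm.

(** * Limits of geometric sequences of operators *)

Lemma geometric_limit (R : realType) (V : completeNormedModType R) (c : R)
    (u : nat -> V) : (forall n, `|u n.+1 - u n| <= c * 2^-1 ^+ n) ->
  exists l, forall n, `|l - u n| <= 2 * c * 2^-1 ^+ n.
Proof.
move=> uc.
have pow0 n : 0 < 2^-1 ^+ n :> R by rewrite exprn_gt0.
have c0 : 0 <= c by have := le_trans (normr_ge0 _) (uc 0%N); rewrite expr0 mulr1.
have uk n k : `|u (n + k)%N - u n| <=
    2 * c * 2^-1 ^+ n - 2 * c * 2^-1 ^+ (n + k).
  elim: k => [|k IH]; first by rewrite addn0 !subrr normr0.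
  rewrite addnS; apply: le_trans (ler_distD (u (n + k)%N) _ _) _.
  have := uc (n + k)%N; rewrite exprS.
  set a := `|_ - _|; move=> ha; move: IH; set b := `|_|; move=> hb; lra.
have um n m : (n <= m)%N -> `|u m - u n| <= 2 * c * 2^-1 ^+ n.
  move=> nm; have := uk n (m - n)%N; rewrite subnKC// => /le_trans; apply.
  by rewrite gerBl// !mulr_ge0// ltW.
have : cvg (u @ \oo).
  apply: cauchy_cvg; apply: cauchy_exP => e e0.
  have [n ne] := half_pow_small (2 * c) e0.
  exists (u n); exists n => // m /= nm; rewrite -ball_normE/= distrC.
  exact: le_lt_trans (um _ _ nm) ne.
move=> /cvg_ex[l /= ul]; exists l => n; apply/ler_addgt0Pr => e e0.
have /cvgrPdist_lt/(_ _ e0)[N _ Nl] := ul.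
have := Nl (maxn N n) (leq_maxl _ _) => /= lN.
apply: le_trans (ler_distD (u (maxn N n)) _ _) _.
by rewrite addrC; apply: lerD; [exact: um (leq_maxr _ _)|exact: ltW].
Qed.

(** The limit exists pointwise, and the bounds make it linear.  The hypothesis
    bounds the increments in norm without asking them to lie in P, which serves
    both for the operators T n, whose increments are controlled through their
    majorants, and for the partial sums of these majorants. *)
Lemma geometric_operator_limit (R : realType) (E F : banachLatticeType R)
    (c : R) (T : nat -> E -> F) : 0 <= c -> (forall n, linear (T n)) ->
  (forall n x, `|T n.+1 x - T n x| <= c * 2^-1 ^+ n * `|x|) ->
  exists2 L : E -> F, linear L &
    forall n x, `|L x - T n x| <= 2 * c * 2^-1 ^+ n * `|x|.
Proof.
move=> c0 lT Tc.
have /choice[L LT] : forall x, exists l, forall n,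
    `|l - T n x| <= 2 * c * 2^-1 ^+ n * `|x|.
  move=> x; have [n|l lT'] := @geometric_limit _ _ (c * `|x|) (fun n => T n x).
    by rewrite mulrAC.
  by exists l => n; apply: le_trans (lT' n) _; rewrite mulrA mulrAC.
exists L => // a x y.
apply/eqP; rewrite -subr_eq0 -normr_le0; apply/ler_addgt0Pr => e e0; rewrite add0r.
pose k := 2 * c * (`|a *: x + y| + `|a| * `|x| + `|y|).
have [n ne] := half_pow_small k e0; apply: le_trans (ltW ne).
have -> : L (a *: x + y) - (a *: L x + L y) =
    (L (a *: x + y) - T n (a *: x + y)) - (a *: (L x - T n x) + (L y - T n y)).
  rewrite lT scalerBr [a *: L x - _ + _]addrACA -opprD.
  by rewrite [in RHS]opprB addrA subrK.
apply: le_trans (ler_normB _ _) _.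
have h := ler_normD (a *: (L x - T n x)) (L y - T n y); rewrite normrZ in h.
have hx : `|a| * `|L x - T n x| <= `|a| * (2 * c * 2^-1 ^+ n * `|x|).
  exact: ler_wpM2l.
have := LT (a *: x + y) n; have := LT y n; rewrite /k => hy hxy.
lra.
Qed.

(** * Regularly P-operators and the enveloping norm *)

Section EnvelopingNorm.
Variables (R : realType) (E F : banachLatticeType R) (P : set (E -> F)).
Hypothesis P_subspace : operator_subspace P.
Hypothesis P_domination : domination_property P.
Implicit Types S T M : E -> F.

Let Pbounded T : P T -> bounded_operators T.
Proof. by case: P_subspace => + _ _; exact. Qed.

Let P0 : P 0. Proof. by case: P_subspace. Qed.

Let PZ a T : P T -> P (a *: T).
Proof.
by case: P_subspace => _ _ lP PT; rewrite -[a *: T]addr0; exact: lP.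
Qed.

Let PD S T : P S -> P T -> P (S + T).
Proof. by case: P_subspace => _ _ lP PS PT; rewrite -[S]scale1r; exact: lP. Qed.

Let PB S T : P S -> P T -> P (S - T).
Proof. by move=> PS PT; rewrite -scaleN1r; apply: PD => //; exact: PZ. Qed.

(** The domination property requires S to be continuous; a positive linear map
    below a continuous one always is. *)
Lemma dominated_mem S M : linear S -> op_le 0 S -> op_le S M -> P M -> P S.
Proof.
move=> lS S0 SM PM.
have MS : majorizes M S.
  split=> // x x0; apply: vle_trans (SM _ x0).
  by apply: vopp_le_self; exact: S0.
apply: (P_domination _ (Pbounded PM)) => //.
apply: bounded_operator_of_le => // x.
exact: majorizes_norm (Pbounded PM) MS.
Qed.

(** From T = T1 - T2 the majorant is T1 + T2.  Conversely T = M - (M - T), where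
    0 <= M - T <= M + M. *)
Lemma regularlyP T :
  regularly P T <-> linear T /\ exists2 M, P M & majorizes M T.
Proof.
split=> [[T1 [T2 [PT1 T10 PT2 T20 ->]]]|[lT [M PM MT]]].
  have [lT1 _] := Pbounded PT1; have [lT2 _] := Pbounded PT2.
  split; first exact: linearB_fun.
  exists (T1 + T2); first exact: PD.
  split=> x x0.
    apply: vle_add2l; by apply: vopp_le_self; exact: T20.
  rewrite opprB addrC; apply: vle_add2r.
  by apply: vopp_le_self; exact: T10.
have M0 := majorizes_ge0 MT; have [TM NTM] := MT.
have [lM _] := Pbounded PM.
have MT0 : op_le 0 (M - T) by move=> x x0; apply/vsub_ge0; exact: TM.
exists M, (M - T); split=> //; last by rewrite opprB addrC subrK.
apply: (@dominated_mem _ (M + M)) => //; last exact: PD.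
  exact: linearB_fun.
by move=> x x0; apply: vle_add2l; exact: NTM.
Qed.

Lemma regularly_linear T : regularly P T -> linear T.
Proof. by move=> /regularlyP[]. Qed.

Lemma regularly_axpy a S T :
  regularly P S -> regularly P T -> regularly P (a *: S + T).
Proof.
move=> /regularlyP[lS [M PM MS]] /regularlyP[lT [N PN NT]].
apply/regularlyP; split; first exact: linear_axpy.
exists (`|a| *: M + N); first by apply: PD => //; exact: PZ.
by apply: majorizesD => //; exact: majorizesZ.
Qed.

(** A majorant is positive, hence majorizes itself.  So the operators over which
    the infimum of the enveloping norm runs are upper bounds of T and - T within
    the regularly P-operators. *)
Lemma regularly_majorant M T : P M -> majorizes M T -> regularly P M.
Proof.
move=> PM /majorizes_ge0 M0; apply/regularlyP.
split; first by have [] := Pbounded PM.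
exists M => //; split=> x x0; first exact: vle_refl.
by apply: vopp_le_self; exact: M0.
Qed.

(** If M majorizes S and N majorizes U, then - M <= S <= T <= U <= N, so that
    M + N majorizes T. *)
Lemma regularly_between S T U : linear T -> regularly P S -> regularly P U ->
  op_le S T -> op_le T U -> regularly P T.
Proof.
move=> lT /regularlyP[lS [M PM [SM NSM]]] /regularlyP[lU [N PN [UN NUN]]] ST TU.
apply/regularlyP; split => //; exists (M + N); first exact: PD.
have M0 : op_le 0 M by exact: (@majorizes_ge0 _ _ _ _ S).
have N0 : op_le 0 N by exact: (@majorizes_ge0 _ _ _ _ U).
split=> x x0.
  rewrite -[T x]add0r; apply: vle_add; first exact: M0.
  by apply: vle_trans (UN _ x0); exact: TU.
rewrite -[X in X <=v _]addr0; apply: vle_add; last exact: N0.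
by apply: vle_trans (NSM _ x0); apply: vle_opp; exact: ST.
Qed.

Let env_set T :=
  [set opnorm S | S in [set S | [/\ P S, op_le T S & op_le (- T) S]]].

Let env_set_lb T : has_lbound (env_set T).
Proof.
by exists 0 => _ [M [PM _ _] <-]; apply: opnorm_ge0; exact: Pbounded.
Qed.

Let env_set_nonempty T : regularly P T -> env_set T !=set0.
Proof. by move=> /regularlyP[_ [M PM [TM NTM]]]; exists (opnorm M), M. Qed.

Lemma enveloping_norm_le T M : P M -> majorizes M T ->
  enveloping_norm P T <= opnorm M.
Proof. by move=> PM [TM NTM]; apply: ge_inf; [exact: env_set_lb|exists M]. Qed.

Lemma le_enveloping_norm T (c : R) : regularly P T ->
  (forall M, P M -> majorizes M T -> c <= opnorm M) -> c <= enveloping_norm P T.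
Proof.
move=> DT cP; apply: lb_le_inf; first exact: env_set_nonempty.
by move=> _ [M [PM TM NTM] <-]; exact: cP.
Qed.

Lemma enveloping_norm_ge0 T : regularly P T -> 0 <= enveloping_norm P T.
Proof.
move=> DT; apply: le_enveloping_norm => // M PM _.
by apply: opnorm_ge0; exact: Pbounded.
Qed.

Lemma enveloping_norm_adherent T (e : R) : regularly P T -> 0 < e ->
  exists M, [/\ P M, majorizes M T & opnorm M < enveloping_norm P T + e].
Proof.
move=> DT e0; have hi : has_inf (env_set T) by split; [exact: env_set_nonempty|].
by have [_ [M [PM TM NTM] <-] Me] := inf_adherent e0 hi; exists M.
Qed.

Lemma norm_le_enveloping_norm T x : regularly P T ->
  `|T x| <= enveloping_norm P T * `|x|.
Proof.
move=> DT; have lT := regularly_linear DT.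
have [->|x0] := eqVneq x 0; first by rewrite linfun0// !normr0 mulr0.
rewrite -ler_pdivrMr ?normr_gt0//; apply: le_enveloping_norm => // M PM MT.
by rewrite ler_pdivrMr ?normr_gt0//; apply: majorizes_norm => //; exact: Pbounded.
Qed.

Lemma enveloping_normD S T : regularly P S -> regularly P T ->
  enveloping_norm P (S + T) <= enveloping_norm P S + enveloping_norm P T.
Proof.
move=> DS DT; rewrite -lerBlDr; apply: le_enveloping_norm => // M PM MS.
rewrite lerBlDr -lerBlDl; apply: le_enveloping_norm => // N PN NT.
rewrite lerBlDl; apply: le_trans (opnormD (Pbounded PM) (Pbounded PN)).
by apply: enveloping_norm_le; [exact: PD|exact: majorizesD].
Qed.

(** The inequality <= for a nonzero scalar suffices: applied to the inverse scalar
    it gives the converse. *)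
Lemma enveloping_normZ a T : regularly P T ->
  enveloping_norm P (a *: T) = `|a| * enveloping_norm P T.
Proof.
have le b S : regularly P S -> b != 0 ->
    enveloping_norm P (b *: S) <= `|b| * enveloping_norm P S.
  move=> DS b0; rewrite -ler_pdivrMl ?normr_gt0//.
  apply: le_enveloping_norm => // M PM MS; rewrite ler_pdivrMl ?normr_gt0//.
  rewrite -[X in _ <= X * _]normr_id.
  apply: le_trans (opnormZ_le `|b| (Pbounded PM)).
  by apply: enveloping_norm_le; [exact: PZ|exact: majorizesZ].
have D0 : regularly P 0.
    by exists 0, 0; split; rewrite ?subrr// => x _; exact: vle_refl.
move=> DT; have [->|a0] := eqVneq a 0.
  rewrite scale0r normr0 mul0r; apply/eqP; rewrite eq_le enveloping_norm_ge0//.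
  rewrite andbT; apply: (@le_trans _ _ (opnorm (0 : E -> F))).
    apply: enveloping_norm_le => //.
    by split=> x _; rewrite ?oppr0; exact: vle_refl.
  by apply: opnorm_le => // x; rewrite normr0 mul0r.
have DaT : regularly P (a *: T) by rewrite -[_ *: _]addr0; exact: regularly_axpy.
apply/eqP; rewrite eq_le le//= -ler_pdivlMl ?normr_gt0//.
have := le _ _ DaT (invr_neq0 a0); rewrite scalerA mulVf// scale1r normfV.
by [].
Qed.

Lemma enveloping_norm_eq0 T : regularly P T -> enveloping_norm P T = 0 -> T = 0.
Proof.
move=> DT T0; apply/funext => x; apply/eqP; rewrite -normr_le0.
by have := norm_le_enveloping_norm x DT; rewrite T0 mul0r.
Qed.

Lemma enveloping_norm_mono S T : regularly P S -> regularly P T ->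
  (forall M, regularly P M -> op_le T M -> op_le (- T) M ->
    op_le S M /\ op_le (- S) M) ->
  enveloping_norm P S <= enveloping_norm P T.
Proof.
move=> DS DT ST; apply: le_enveloping_norm => // M PM MT.
apply: enveloping_norm_le => //.
have DM := regularly_majorant PM MT.
by have [TM NTM] := MT; exact: ST.
Qed.

Hypothesis P_closed : opnorm_closed P.

(** The series of the majorants M n of the increments converges in operator norm
    to an element of P by closedness, and its tails W - U n majorize L - T n. *)
Lemma enveloping_norm_complete (T : nat -> E -> F) :
  (forall n, regularly P (T n)) ->
  (forall n, enveloping_norm P (T n.+1 - T n) <= 2^-1 ^+ n) ->
  exists2 L, regularly P L &
    forall n, enveloping_norm P (L - T n) <= 4 * 2^-1 ^+ n.
Proof.
move=> DT Tn.
have pow0 n : 0 < 2^-1 ^+ n :> R by rewrite exprn_gt0.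
have DB S U : regularly P S -> regularly P U -> regularly P (U - S).
  by move=> DS DU; rewrite addrC -scaleN1r; exact: regularly_axpy.
have /choice[M MP] : forall n, exists M,
    [/\ P M, majorizes M (T n.+1 - T n) & opnorm M <= 2 * 2^-1 ^+ n].
  move=> n; have [M [PM MT Me]] :=
    enveloping_norm_adherent (DB _ _ (DT n) (DT n.+1)) (pow0 n).
  by exists M; split=> //; have := Tn n; lra.
pose U n : E -> F := \sum_(k < n) M k.
have US n : U n.+1 = U n + M n by rewrite /U big_ord_recr.
have PU n : P (U n).
  elim: n => [|n IH]; first by rewrite /U big_ord0.
  by rewrite US; apply: PD => //; have [] := MP n.
have lT n : linear (T n) by exact: regularly_linear.
have lU n : linear (U n) by have [] := Pbounded (PU n).
have [|n x|L lL LT] := geometric_operator_limit _ lT (c := 1).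
- by [].
- rewrite mul1r.
  apply: le_trans (norm_le_enveloping_norm x (DB _ _ (DT n) (DT n.+1))) _.
  exact: ler_wpM2r.
have [|n x|W lW WU] := geometric_operator_limit _ lU (c := 2).
- by [].
- have [PM _ Me] := MP n.
  rewrite US -[X in `|X - _|]/(U n x + M n x) addrC addKr.
  apply: le_trans (opnorm_bound x (Pbounded PM)) _.
  exact: ler_wpM2r.
have WU' n : opnorm (W - U n) <= 4 * 2^-1 ^+ n.
  apply: opnorm_le => [|x]; first by rewrite mulr_ge0// ltW.
  by apply: le_trans (WU n x) _; apply: ler_wpM2r => //; lra.
have PW : P W.
  apply: P_closed.
    apply: (@bounded_operator_of_le _ _ _ _ 4) => // x.
    have := WU 0%N x; rewrite /U big_ord0 expr0 subr0; lra.
  move=> e e0; have [n ne] := half_pow_small 4 e0.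
  by exists (U n) => //; exact: le_lt_trans (WU' n) ne.
have PWU n : P (W - U n) by exact: PB.
have UT n m : (n <= m)%N -> majorizes (U m - U n) (T m - T n).
  move=> /subnKC <-; elim: (m - n)%N => [|k [IH1 IH2]].
    by rewrite addn0 !subrr; split=> x _; rewrite ?oppr0; exact: vle_refl.
  rewrite addnS US.
  have -> : T (n + k).+1 - T n =
      (T (n + k)%N - T n) + (T (n + k).+1 - T (n + k)%N).
    by rewrite [RHS]addrC subrKA.
  rewrite addrAC; apply: majorizesD => //.
  by have [] := MP (n + k)%N.
have WUT n : majorizes (W - U n) (L - T n).
  (* The order relations between U m - U n and T m - T n pass to the limit in m,
     because x is fixed and the positive cone is closed. *)
  have close (e : R) x : 0 < e -> exists2 m, (n <= m)%N &
      `|W x - U m x| + `|L x - T m x| <= e.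
    (* 6 = 4 + 2 adds the rates of convergence of U and of T. *)
    move=> e0; have [m me] := half_pow_small (6 * `|x|) e0.
    exists (maxn n m); first exact: leq_maxl.
    have mm : 2^-1 ^+ (maxn n m) <= 2^-1 ^+ m :> R.
      by apply: ler_wiXn2l; rewrite ?leq_maxr//; lra.
    apply: le_trans (ltW me).
    have := ler_wpM2r (normr_ge0 x) mm.
    have := WU (maxn n m) x; have := LT (maxn n m) x.
    lra.
  have sh (p q r : F) : p - r - (q - r) = p - q by rewrite opprB subrKA.
  have add2 (p q r s : F) : p + q - (r + s) = p - r + (q - s).
    by rewrite opprD addrACA.
  have sub2 (p q r s : F) : p - q - (r - s) = p - r - (q - s).
    by rewrite add2 -opprD.
  split=> x x0; apply/vsub_ge0; apply: vle0_closed => e e0.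
    have [m nm me] := close e x e0; have [/(_ x x0)/vsub_ge0 h _] := UT _ _ nm.
    exists (U m x - U n x - (T m x - T n x)) => //.
    rewrite -[X in X - (_ - (_ - _))]/(W x - U n x - (L x - T n x)).
    have -> : W x - U n x - (L x - T n x) - (U m x - U n x - (T m x - T n x))
        = (W x - U m x) - (L x - T m x).
      by rewrite sub2 !sh.
    by apply: le_trans (ler_normB _ _) _.
  have [m nm me] := close e x e0; have [_ /(_ x x0)/vsub_ge0 h] := UT _ _ nm.
  exists (U m x - U n x + (T m x - T n x)); first by rewrite -[_ - T n x]opprK.
  rewrite -[X in X - (_ + (_ - _))]/(W x - U n x - - (L x - T n x)).
  have -> : W x - U n x - - (L x - T n x) - (U m x - U n x + (T m x - T n x))
      = (W x - U m x) + (L x - T m x).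
    by rewrite opprK add2 !sh.
  by apply: le_trans (ler_normD _ _) _.
have DLT n : regularly P (L - T n).
  by apply/regularlyP; split; [exact: linearB_fun|exists (W - U n)].
exists L.
  rewrite -[L](subrK (T 0%N)) -[_ - _]scale1r; exact: regularly_axpy.
move=> n; apply: le_trans (enveloping_norm_le (PWU n) (WUT n)) _.
exact: WU'.
Qed.

End EnvelopingNorm.

Theorem theorem7 (R : realType) (E F : banachLatticeType R)
    (F_dedekind_complete : dedekind_complete F)
    (P : set (E -> F))
    (P_subspace : operator_subspace P)
    (P_closed : opnorm_closed P)
    (P_domination : domination_property P) :
  dedekind_complete_banach_lattice_on
    (regularly P) (@op_le R E F) (enveloping_norm P).
Proof.
have D0 : regularly P 0.
  have [_ P0 _] := P_subspace.
  by exists 0, 0; split; rewrite ?subrr// => x _; exact: vle_refl.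
apply: dedekind_banach_subspace; split=> //.
- by move=> a S T; exact: regularly_axpy.
- by move=> T _ x _; exact: vle_refl.
- by move=> S T DS DT; apply: op_le_anti;
    apply: (regularly_linear P_subspace P_domination).
- by move=> T S U _ _ _ ST TU x x0; apply: vle_trans (TU _ x0); exact: ST.
- by move=> U S T _ _ _ ST x x0; apply: vle_add2r; exact: ST.
- by move=> a T _ a0 T0 x x0; apply: vle_scale_ge0 => //; exact: T0.
- move=> S T /(regularlyP P_subspace P_domination)[_ [M PM MS]].
  move=> /(regularlyP P_subspace P_domination)[_ [N PN NT]].
  have DM := regularly_majorant P_subspace P_domination PM MS.
  have DN := regularly_majorant P_subspace P_domination PN NT.
  exists (M + N); split.
  + by rewrite -[M]scale1r; exact: regularly_axpy.
  + move=> x x0; rewrite -[S x]addr0; apply: vle_add.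
      by have [SM _] := MS; exact: SM.
    exact: majorizes_ge0 NT _ x0.
  + move=> x x0; rewrite -[T x]add0r; apply: vle_add.
      exact: majorizes_ge0 MS _ x0.
    by have [TN _] := NT; exact: TN.
- move=> A AD [T0 AT0] [U DU AU].
  have lA T : A T -> linear T.
    by move=> /AD; exact: regularly_linear.
  have lU := regularly_linear P_subspace P_domination DU.
  have [|S [lS AS Sle]] := operator_supremum lA F_dedekind_complete _ lU AU.
    by exists T0.
  exists S; split=> //.
    apply: regularly_between (AD _ AT0) DU (AS _ AT0) (Sle _ lU AU) => //.
  by move=> W DW AW; apply: Sle => //; exact: regularly_linear DW.
- by move=> S T; exact: enveloping_normD.
- by move=> a T; exact: enveloping_normZ.
- by move=> T; exact: enveloping_norm_eq0.
- by move=> S T; exact: enveloping_norm_mono.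
- by move=> T; exact: enveloping_norm_complete.
Qed.
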